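(* Let $r\ge4$. If $n^{-2/(r+1)} \ll p \le (\log n)^{-2/(r-2)}$, then with high probability as $n\to\infty$, \[S_r(n,p) \le \exp\bigg(\frac{O\big(n(\log n)^{1+1/(r-2)}\big)}{p^{(r-1)/2}}\bigg).\]
   Context: $G(n,p)$ is the Erdős–Rényi random graph on $n$ vertices with edge probability $p=p(n)$. $S_r(n,p)$ is the number of orientations of $G(n,p)$ in which no copy of $K_r$ is strongly connected. $f\ll g$ means $f/g\to0$ as $n\to\infty$; $O(\cdot)$ hides a constant depending only on $r$. *)

(* Defs.v *)
From mathcomp Require Import all_boot all_order all_algebra.
From mathcomp Require Import all_classical all_reals all_analysis.

Set Implicit Arguments.
Unset Strict Implicit.
Unset Printing Implicit Defensive.

Import Order.TTheory GRing.Theory Num.Theory.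
Import numFieldNormedType.Exports.

Local Open Scope ring_scope.

(* A simple graph on 'I_n is its edge set: a set of 2-element subsets. *)
Definition pairs (n : nat) : {set {set 'I_n}} := [set e : {set 'I_n} | #|e| == 2]%SET.

Definition graphs (n : nat) : {set {set {set 'I_n}}} := powerset (pairs n).

Definition Gnp_weight (R : realType) (n : nat) (p : R) (G : {set {set 'I_n}}) : R :=
  \prod_(e in pairs n) (if e \in G then p else 1 - p).

Definition Gnp_prob (R : realType) (n : nat) (p : R)
    (E : pred {set {set 'I_n}}) : R :=
  \sum_(G in graphs n | E G) Gnp_weight p G.

(* For u = v the set [set u; v] is a singleton, hence not an edge, so an
   orientation has no loops. *)
Definition is_orientation (n : nat) (G : {set {set 'I_n}})
    (D : {set 'I_n * 'I_n}) : bool :=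
  [forall u : 'I_n, forall v : 'I_n,
     if [set u; v]%SET \in G then ((u, v) \in D) (+) ((v, u) \in D)
     else (u, v) \notin D].

Definition is_clique (n : nat) (G : {set {set 'I_n}}) (A : {set 'I_n}) : bool :=
  [forall u in A, forall v in A, (u != v) ==> ([set u; v]%SET \in G)].

(* Strong connectivity of the sub-digraph of D induced by A: the directed
   paths have to stay inside A. *)
Definition strongly_connected (n : nat) (D : {set 'I_n * 'I_n})
    (A : {set 'I_n}) : bool :=
  [forall u in A, forall v in A,
     connect [rel x y | [&& x \in A, y \in A & (x, y) \in D]] u v].

Definition no_strong_clique (r n : nat) (G : {set {set 'I_n}})
    (D : {set 'I_n * 'I_n}) : bool :=
  [forall A : {set 'I_n},
     (#|A| == r) && is_clique G A ==> ~~ strongly_connected D A].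

Definition S_count (r n : nat) (G : {set {set 'I_n}}) : nat :=
  #|[set D : {set 'I_n * 'I_n} | is_orientation G D && no_strong_clique r G D]%SET|.

Local Open Scope classical_set_scope.

(* f << g, i.e. f / g --> 0; as x / 0 = 0 here, g must be required to be
   eventually nonzero. *)
Definition much_less (R : realType) (f g : nat -> R) : Prop :=
  (\forall n \near \oo, g n != 0) /\ (fun n => f n / g n) @ \oo --> (0 : R).

Definition whp (R : realType) (p : nat -> R)
    (E : forall n : nat, pred {set {set 'I_n}}) : Prop :=
  (fun n => Gnp_prob (p n) (E n)) @ \oo --> (1 : R).

(* Main.v *)
Require Import Defs.
From mathcomp Require Import all_boot all_order all_algebra.
From mathcomp Require Import all_classical all_reals all_analysis.
From mathcomp Require Import ring lra.
Import Order.TTheory GRing.Theory Num.Theory.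
Import numFieldNormedType.Exports.

Set Implicit Arguments.
Unset Strict Implicit.
Unset Printing Implicit Defensive.

(* Write [s = r - 1]. Orient the edges vertex by vertex. When [v] is added, let
   [x => y] for earlier neighbours [x], [y] of [v] mean that some [K_s] among them
   carries a directed Hamiltonian path from [x] to [y]; every [K_s] produces such
   a pair. If no [K_r] is strong, the out-neighbourhood of [v] is closed under
   [=>], so it is determined by a minimal generating set, which is independent for
   [=>] and hence contains no [K_s]. If every [m]-set of [G] contains a [K_s], each
   vertex thus has at most [(n + 1) ^ m] choices, and [S_r(G) <= (n + 1) ^ (m n)].
   By Janson's inequality and a union bound over [m]-sets, this hypothesis holds
   with high probability for [m] of order [(log n) ^ (1 / (s - 1)) / p ^ (s / 2)];
   the upper bound on [p] is what makes the pairs of cliques sharing a single edge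
   harmless. *)

Lemma bin_le_exp n m : ('C(n, m) <= n ^ m)%N.
Proof.
apply: (@leq_trans (n ^_ m)); first by rewrite -bin_ffact leq_pmulr ?fact_gt0.
by elim: m => // m IHm; rewrite ffactnSr expnSr leq_mul // leq_subr.
Qed.

(** * Counting orientations *)

Section Generators.
Variables (T : finType) (h : rel T).

Definition reach (I : {set T}) : {set T} :=
  [set y | [exists x in I, connect h x y]]%SET.

Lemma reachP (I : {set T}) y :
  reflect (exists2 x, x \in I & connect h x y) (y \in reach I).
Proof. by rewrite inE; apply: (iffP exists_inP). Qed.

Lemma reach_closed (A : {set T}) :
  (forall x y, h x y -> x \in A -> y \in A) -> reach A = A.
Proof.
move=> hA; apply/setP=> y; apply/reachP/idP => [[x xA]|yA]; last by exists y.
case/connectP=> p; elim: p x xA => [|z p IHp] x xA /=; first by move=> _ ->.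
by case/andP=> /hA /(_ xA) zA; exact: IHp.
Qed.

(** The default [A] of the [arg min] is an admissible candidate as soon as [A] is closed under [h],
    since then [reach A = A]. *)
Definition gens (A : {set T}) : {set T} :=
  [arg min_(I < A | reach I == A) #|I|].

(** If [h x y] held for distinct generators, [y] could be dropped, because [x] reaches whatever [y]
    reaches; this contradicts minimality. *)
Lemma gensP (A : {set T}) : (forall x y, h x y -> x \in A -> y \in A) ->
  reach (gens A) = A /\
  {in gens A &, forall x y, x != y -> ~~ h x y}.
Proof.
move=> hA; rewrite /gens; case: arg_minnP => [|I /eqP IA minI].
  by rewrite reach_closed.
split=> // x y xI yI xy; apply/negP => hxy.
suff /minI : reach (I :\ y)%SET == A by rewrite (cardsD1 y I) yI ltnn.
apply/eqP; rewrite -IA; apply/setP => z; apply/reachP/reachP => -[w].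
  by rewrite !inE => /andP[_ wI] cwz; exists w.
have [->|wy] := eqVneq w y => wI cwz; last by exists w; rewrite // !inE wy.
by exists x; [rewrite !inE xy|apply: connect_trans cwz; exact: connect1].
Qed.

End Generators.

(** * Encoding an orientation by generating sets *)

Section Encoding.
Variables (r n : nat) (G : {set {set 'I_n}}).
Implicit Types (D : {set 'I_n * 'I_n}) (A : {set 'I_n}) (v x y z : 'I_n).

Definition within D A : rel 'I_n := [rel x y | [&& x \in A, y \in A & (x, y) \in D]].

Definition earlier v : {set 'I_n} := [set u : 'I_n | (u < v)%N && ([set u; v]%SET \in G)]%SET.

Definition earlier_out D v : {set 'I_n} := [set u in earlier v | (v, u) \in D]%SET.

(* [spans D v x y] and [v -> x] force [v -> y]: otherwise [A] together with [v] is
   a strongly connected [K_r]. *)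
Definition spans D v : rel 'I_n := fun x y =>
  [exists A : {set 'I_n}, [&& A \subset earlier v, #|A| == r.-1, is_clique G A,
     x \in A, y \in A, x != y &
     [forall z in A, connect (within D A) x z && connect (within D A) z y]]].

Definition code D : {ffun 'I_n -> {set 'I_n}} :=
  [ffun v => gens (spans D v) (earlier_out D v)].

Lemma cliqueP A : reflect {in A &, forall x y, x != y -> [set x; y]%SET \in G} (is_clique G A).
Proof.
apply: (iffP forall_inP) => [h x y xA yA|h x xA].
  by move/forall_inP: (h x xA) => /(_ y yA) /implyP.
by apply/forall_inP=> y yA; apply/implyP; exact: h.
Qed.

Lemma orientation_edge D x y : is_orientation G D -> [set x; y]%SET \in G ->
  ((x, y) \in D) = ((y, x) \notin D).
Proof.
move=> /forallP/(_ x)/forallP/(_ y) + xyG; rewrite xyG.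
by case: (_ \in D); case: (_ \in D).
Qed.

(* Any total relation, transitive or not, is sorted by merge sort, which yields
   a Hamiltonian path of the tournament induced on the clique. *)
Lemma clique_ends D A : is_orientation G D -> is_clique G A -> (1 < #|A|)%N ->
  exists x y, [/\ x \in A, y \in A, x != y &
    [forall z in A, connect (within D A) x z && connect (within D A) z y]].
Proof.
move=> oD /cliqueP cA A1.
pose e : rel 'I_n := fun x y => (x == y) || ((x, y) \in D).
have tot : {in A &, total e}.
  move=> x y xA yA; rewrite /e; have [//|xy] := eqVneq x y.
  by rewrite /= (orientation_edge oD (cA _ _ xA yA xy)); case: ((y, x) \in D); rewrite ?orbT.
pose s := sort e (enum A).
have sA : s =i A by move=> x; rewrite mem_sort mem_enum.
have us : uniq s by rewrite sort_uniq enum_uniq.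
have ss : sorted e s.
  by apply: (sort_sorted_in tot); apply/allP => x; rewrite mem_enum.
have szs : (1 < size s)%N by rewrite size_sort -cardE.
have stp x y : x \in A -> y \in A -> e x y -> connect (within D A) x y.
  move=> xA yA /orP[/eqP->//|xy]; apply: connect1; by rewrite /within /= xA yA.
have x0 : 'I_n by move: szs; case: (s).
have nthA i : (i < size s)%N -> nth x0 s i \in A by move=> ?; rewrite -sA mem_nth.
have conn i j : (i <= j < size s)%N ->
    connect (within D A) (nth x0 s i) (nth x0 s j).
  case/andP; elim: j => [|j IHj]; first by rewrite leqn0 => /eqP ->.
  rewrite leq_eqVlt => /predU1P[->//|ij] js.
  apply: (connect_trans (IHj ij (ltnW js))); apply: stp; try exact: nthA.
    exact/nthA/ltnW.
  exact: (sortedP x0 ss).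
exists (nth x0 s 0), (nth x0 s (size s).-1); split.
- exact/nthA/ltnW.
- by apply: nthA; rewrite ltn_predL ltnW.
- by rewrite nth_uniq // ?ltn_predL ?(ltnW szs) //; case: (size s) szs => // -[].
apply/forall_inP=> z; rewrite -sA => /(nthP x0) [i si <-].
rewrite !conn ?leq0n //=; case: (size s) si => // k; rewrite ltnS => -> /=.
by rewrite ltnSn.
Qed.

Lemma earlier_out_closed D v x y : (0 < r)%N ->
  is_orientation G D -> no_strong_clique r G D ->
  spans D v x y -> x \in earlier_out D v -> y \in earlier_out D v.
Proof.
move=> r0 oD /forallP nsc /existsP[A].
case/and5P=> AE cA clA xA /and3P[yA xy /forall_inP con].
rewrite !inE => /andP[_ vx].
have yE := fintype.subsetP AE _ yA; move: (yE); rewrite inE => /andP[yv yvG].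
rewrite yv yvG /=; apply/negPn/negP => vy.
have vA : v \notin A.
  by apply/negP => /(fintype.subsetP AE); rewrite inE ltnn.
have := nsc (v |: A)%SET; rewrite cardsU1 vA (eqP cA) add1n prednK // eqxx /=.
suff -> : is_clique G (v |: A)%SET.
  rewrite /= => /negP; apply.
  pose e := [rel x y | [&& x \in (v |: A)%SET, y \in (v |: A)%SET & (x, y) \in D]].
  have sub z w : connect (within D A) z w -> connect e z w.
    apply: connect_sub => {}z {}w /and3P[zA wA zw]; apply: connect1.
    by rewrite /e /= !inE zA wA zw !orbT.
  have vx1 : connect e v x by apply: connect1; rewrite /e /= !inE eqxx xA vx !orbT.
  have yv1 : connect e y v.
    by apply: connect1; rewrite /e /= !inE eqxx yA orbT (orientation_edge oD yvG) vy.
  (* Each [z] in [A] lies on a closed walk [v -> x ~> z ~> y -> v], where [~>] stands for a path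
     inside [A]. *)
  have both z : z \in (v |: A)%SET -> connect e v z && connect e z v.
    rewrite !inE => /predU1P[->|zA]; first by rewrite connect0.
    have /andP[xz zy] := con z zA.
    by rewrite (connect_trans vx1 (sub _ _ xz)) (connect_trans (sub _ _ zy) yv1).
  apply/forall_inP => z /both/andP[_ zv]; apply/forall_inP => w /both/andP[vw _].
  exact: connect_trans zv vw.
have vG z : z \in A -> [set z; v]%SET \in G.
  by move/(fintype.subsetP AE); rewrite inE => /andP[].
apply/cliqueP => z w; rewrite !inE.
move=> /predU1P[->|zA] /predU1P[->|wA]; rewrite ?eqxx // => zw.
- by rewrite finset.setUC vG.
- exact: vG.
- exact: (cliqueP _ clA).
Qed.

(** An [m]-subset of the generators would contain an [(r - 1)]-clique, and [clique_ends] would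
    relate two distinct generators by [spans]. For the ends to be distinct the clique needs two
    vertices, whence [2 < r]. *)
Lemma code_small D m v : (2 < r)%N ->
  (forall M : {set 'I_n}, #|M| = m ->
     exists A, [/\ A \subset M, #|A| = r.-1 & is_clique G A]) ->
  is_orientation G D -> no_strong_clique r G D -> (#|code D v| < m)%N.
Proof.
move=> r3 hM oD nD; rewrite ffunE ltnNge; apply/negP => mI.
have [rI indI] := gensP (fun x y => @earlier_out_closed D v x y (ltnW (ltnW r3)) oD nD).
set I := gens _ _ in mI rI indI.
have [M MI cM] : exists2 M : {set 'I_n}, M \subset I & #|M| = m.
  have : (0 < #|[set M : {set 'I_n} | M \subset I & #|M| == m]%SET|)%N.
    by rewrite cards_draws bin_gt0.
  by case/card_gt0P => M; rewrite inE => /andP[? /eqP ?]; exists M.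
have [A [AM cA clA]] := hM _ cM; have AI := fintype.subset_trans AM MI.
have A1 : (1 < #|A|)%N by rewrite cA -ltnS prednK // (ltnW (ltnW r3)).
have [x [y [xA yA xy con]]] := clique_ends oD clA A1.
have /negP := indI x y (fintype.subsetP AI _ xA) (fintype.subsetP AI _ yA) xy; apply.
apply/existsP; exists A; rewrite cA eqxx clA xA yA xy con !andbT.
(* Generators belong to [reach I], which is [earlier_out D v], hence to [earlier v]. *)
apply: (fintype.subset_trans AI); apply/fintype.subsetP => z zI.
suff : z \in earlier_out D v by rewrite inE => /andP[].
by rewrite -rI; apply/reachP; exists z.
Qed.

(** Decoding goes vertex by vertex: [spans D v] depends only on the arcs of [D] between vertices
    before [v], and the out-neighbourhood of [v] is recovered as the closure of its generators. *)
Lemma code_inj : (0 < r)%N ->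
  {in [set D | is_orientation G D && no_strong_clique r G D]%SET &, injective code}.
Proof.
move=> r0 D D'; rewrite !inE => /andP[oD nD] /andP[oD' nD'] eqc.
suff agree k x y : (x < k)%N -> (y < k)%N -> ((x, y) \in D) = ((x, y) \in D').
  by apply/setP => -[x y]; exact: (agree n).
elim: k x y => // k IHk.
have out (v u : 'I_n) : v = k :> nat -> u \in earlier v ->
    ((v, u) \in D) = ((v, u) \in D').
  move=> vk uE.
  have spE : spans D v =2 spans D' v.
    move=> x y; apply: eq_existsb => A.
    have [AE|//] := boolP (A \subset _); do 5 congr andb.
    have E : within D A =2 within D' A.
      move=> z w; rewrite /within /=.
      have [zA|//] := boolP (z \in A); have [wA|//] := boolP (w \in A).
      have := fintype.subsetP AE _ zA; have := fintype.subsetP AE _ wA.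
      by rewrite !inE vk => /andP[wk _] /andP[zk _]; rewrite IHk.
    by congr andb; apply: eq_forallb => z; rewrite !(eq_connect E).
  have [rD _] := gensP (fun x y => @earlier_out_closed D v x y r0 oD nD).
  have [rD' _] := gensP (fun x y => @earlier_out_closed D' v x y r0 oD' nD').
  have := congr1 (fun f : {ffun _ -> _} => f v) eqc; rewrite !ffunE => gE.
  have eqo : earlier_out D v = earlier_out D' v.
    rewrite -rD -rD' gE; apply/setP => y; rewrite !inE.
    by apply: eq_existsb => x; rewrite (eq_connect spE).
  by move/setP/(_ u): eqo; rewrite !inE; move: uE; rewrite inE => ->.
(* An edge carries exactly one of its two arcs, so the arcs from [v] to earlier vertices determine
   those coming back. *)
have gen (v u : 'I_n) : v = k :> nat -> (u < k)%N ->
    ((v, u) \in D) = ((v, u) \in D') /\ ((u, v) \in D) = ((u, v) \in D').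
  move=> vk uk; have [uvG|uvG] := boolP ([set u; v]%SET \in G).
    have vuD : ((v, u) \in D) = ((v, u) \in D') by apply: out; rewrite // inE vk uk.
    by rewrite vuD !(orientation_edge _ uvG) // vuD.
  have no (D1 : {set 'I_n * 'I_n}) : is_orientation G D1 ->
      ((v, u) \in D1) = false /\ ((u, v) \in D1) = false.
    move=> /forallP o1; split.
      by have /forallP/(_ u) := o1 v; rewrite finset.setUC (negbTE uvG) => /negbTE.
    by have /forallP/(_ v) := o1 u; rewrite (negbTE uvG) => /negbTE.
  by have [-> ->] := no _ oD; have [-> ->] := no _ oD'.
have loop (v : 'I_n) (D1 : {set 'I_n * 'I_n}) : is_orientation G D1 -> ((v, v) \in D1) = false.
  move=> /forallP/(_ v)/forallP/(_ v); case: ifP => _; first by rewrite addbb.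
  by move/negbTE.
move=> x y; rewrite !ltnS leq_eqVlt => /predU1P[xk|xk]; rewrite leq_eqVlt => /predU1P[yk|yk].
- have -> : y = x by apply: val_inj; rewrite /= xk yk.
  by rewrite !loop.
- by have [] := gen x y xk yk.
- by have [] := gen y x yk xk.
- exact: IHk.
Qed.

Lemma card_small_sets m : (0 < n)%N ->
  (#|[set I : {set 'I_n} | (#|I| < m)%N]%SET| <= n.+1 ^ m)%N.
Proof.
move=> n0; elim: m => [|m IHm].
  by rewrite (_ : [set _ | _]%SET = finset.set0) ?cards0 //; apply/setP => I; rewrite !inE.
have -> : [set I : {set 'I_n} | (#|I| < m.+1)%N]%SET =
   ([set I : {set 'I_n} | (#|I| < m)%N] :|: [set I : {set 'I_n} | #|I| == m])%SET.
  by apply/setP => I; rewrite !inE ltnS leq_eqVlt orbC.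
(* [n.+1 ^ m.+1] splits as [n.+1 ^ m + n * n.+1 ^ m]; the second summand absorbs the sets of size
   [m]. *)
rewrite (leq_trans (leq_card_setU _ _)) // expnS mulSn leq_add //.
rewrite card_draws card_ord (leq_trans (bin_le_exp _ _)) //.
rewrite (leq_trans _ (leq_pmull _ n0)) //.
by case: m {IHm} => // m; rewrite leq_exp2r.
Qed.

Lemma S_count_le m : (2 < r)%N -> (0 < n)%N ->
  (forall M : {set 'I_n}, #|M| = m ->
     exists A, [/\ A \subset M, #|A| = r.-1 & is_clique G A]) ->
  (S_count r G <= (n.+1 ^ m) ^ n)%N.
Proof.
move=> r3 n0 hM; rewrite /S_count -(card_in_imset (code_inj (ltnW (ltnW r3)))).
pose B := [set I : {set 'I_n} | (#|I| < m)%N]%SET.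
apply: (@leq_trans #|[set f : {ffun 'I_n -> {set 'I_n}} | f \in ffun_on (mem B)]%SET|).
  apply: subset_leq_card; apply/fintype.subsetP => f /imsetP[D].
  rewrite inE => /andP[oD nD] ->; rewrite inE; apply/ffun_onP => v; rewrite inE.
  exact: code_small.
by rewrite cardsE card_ffun_on card_ord leq_exp2r // card_small_sets.
Qed.

End Encoding.

Local Open Scope ring_scope.

(** * Janson's inequality *)

Section Bernoulli.
Variables (R : realType) (T : finType) (E : {set T}) (p : R).
Hypothesis p01 : 0 <= p <= 1.
Implicit Types (G S : {set T}) (f g : {set T} -> R).

Definition bern_weight G : R := \prod_(e in E) (if e \in G then p else 1 - p).

(** The ground set is arbitrary because two random sets occur: the edge set of the graph, with [E]
    equal to [pairs n], and the random subfamily of indices in [janson]. *)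
Definition Ex f : R := \sum_(G in powerset E) bern_weight G * f G.

Lemma bern_weight_ge0 G : 0 <= bern_weight G.
Proof.
by apply: prodr_ge0 => e _; case/andP: p01 => p0 p1; case: ifP; rewrite // subr_ge0.
Qed.

Lemma le_Ex f g : (forall G, G \subset E -> f G <= g G) -> Ex f <= Ex g.
Proof.
move=> fg; apply: ler_sum => G; rewrite powersetE => /fg.
exact/ler_wpM2l/bern_weight_ge0.
Qed.

Lemma eq_Ex f g : (forall G, G \subset E -> f G = g G) -> Ex f = Ex g.
Proof. by move=> fg; apply: eq_bigr => G; rewrite powersetE => /fg ->. Qed.

Lemma ExB f g : Ex (fun G => f G - g G) = Ex f - Ex g.
Proof. by rewrite -sumrB; apply: eq_bigr => G _; rewrite mulrBr. Qed.

Lemma ExZ a f : Ex (fun G => a * f G) = a * Ex f.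
Proof. by rewrite mulr_sumr; apply: eq_bigr => G _; rewrite mulrCA. Qed.

Lemma Ex_sum (I : Type) (l : seq I) (P : pred I) (F : I -> {set T} -> R) :
  Ex (fun G => \sum_(i <- l | P i) F i G) = \sum_(i <- l | P i) Ex (F i).
Proof.
by rewrite exchange_big; apply: eq_bigr => G _; rewrite mulr_sumr.
Qed.

Lemma Ex_cst a : Ex (fun=> a) = a.
Proof.
rewrite /Ex -mulr_suml; suff -> : \sum_(G in powerset E) bern_weight G = 1 by rewrite mul1r.
(* Outside [E] the two factors are 0 and 1, so expanding the product of [F e + F' e] over all of [T]
   keeps only the subsets of [E]. *)
pose F e : R := if e \in E then p else 0.
pose F' e : R := if e \in E then 1 - p else 1.
have := @bigA_distr R 0 1 *%R +%R T F F'; rewrite big1 => [|e _]; last first.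
  by rewrite /F /F'; case: ifP => _ /=; rewrite ?add0r // subrKC.
move=> /esym; rewrite (bigID (fun G => G \in powerset E)) /=.
rewrite [X in _ + X]big1 ?addr0 => [|G]; last first.
  rewrite powersetE => /subsetPn[e eG eE].
  by rewrite (bigD1 e) //= eG /F (negbTE eE) mul0r.
move=> H; rewrite -[RHS]H; apply: eq_bigr => G; rewrite powersetE => GE.
rewrite (bigID (fun e => e \in E)) /= [X in _ * X]big1 ?mulr1 => [|e eE].
  by apply: eq_bigr => e eE; rewrite /F /F' eE.
by rewrite ifN ?/F' ?(negbTE eE) //; apply: contra eE; exact: fintype.subsetP.
Qed.

(** The map [G |-> e |: G] pairs the sets avoiding [e] with those containing it; [w] is the weight
    of the other coordinates, and both sides equal [p * W]. *)
Lemma Ex_contains1 e f : e \in E ->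
  Ex (fun G => (e \in G)%:R * f G) = p * Ex (fun G => f (e |: G)%SET).
Proof.
move=> eE; pose w G : R := \prod_(i in E :\ e) (if i \in G then p else 1 - p).
have wE G : bern_weight G = (if e \in G then p else 1 - p) * w G.
  rewrite /bern_weight (bigD1 e) //=; congr (_ * _); apply: eq_bigl => i.
  by rewrite !inE andbC.
have wU G : w (e |: G)%SET = w G.
  by apply: eq_bigr => i; rewrite !inE => /andP[/negbTE-> _].
pose W := \sum_(G in powerset E | e \notin G) w G * f (e |: G)%SET.
have WE h : \sum_(G in powerset E | e \in G) bern_weight G * h G =
    p * \sum_(G in powerset E | e \notin G) w G * h (e |: G)%SET.
  rewrite (reindex_onto (fun G => e |: G)%SET (fun G => G :\ e)%SET) /=; last first.
    by move=> G /andP[_ eG]; rewrite finset.setD1K.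
  rewrite mulr_sumr; apply: eq_big => [G|G /andP[_ /eqP]].
    rewrite !powersetE finset.subUset finset.sub1set eE setU11 andbT /=; congr andb.
    apply/eqP/idP => [<-|eG]; first by rewrite !inE eqxx.
    by rewrite finset.setU1K.
  by move=> _; rewrite wE setU11 wU mulrA.
have -> : Ex (fun G => (e \in G)%:R * f G) = p * W.
  rewrite /Ex (bigID (fun G => e \in G)) /= [X in _ + X]big1 ?addr0; last first.
    by move=> G /andP[_ /negbTE->]; rewrite mul0r mulr0.
  rewrite -(WE f).
  by apply: eq_bigr => G /andP[_ ->]; rewrite mul1r.
congr (_ * _); rewrite /Ex (bigID (fun G => e \in G)) /=.
rewrite (WE (fun G => f (e |: G)%SET)).
rewrite (eq_bigr (fun G => w G * f (e |: G)%SET)); last first.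
  by move=> G _; rewrite finset.setUA finset.setUid.
rewrite [X in _ + X](eq_bigr (fun G => (1 - p) * (w G * f (e |: G)%SET))); last first.
  by move=> G /andP[_ /negbTE eG]; rewrite wE eG mulrA.
by rewrite -mulr_sumr -/W -mulrDl subrKC mul1r.
Qed.

(* Conditioning on [S \subset G] amounts to adding [S] to the random set; this
   gives both the independence and the Harris inequality needed below. *)
Lemma Ex_contains S f : S \subset E ->
  Ex (fun G => (S \subset G)%:R * f G) = p ^+ #|S| * Ex (fun G => f (S :|: G)%SET).
Proof.
have [k] := ubnP #|S|; elim: k S f => // k IHk S f.
have [->|/set0Pn[e eS]] := eqVneq S finset.set0.
  move=> _ _; rewrite cards0 expr0 mul1r; apply: eq_Ex => G _.
  by rewrite finset.sub0set mul1r finset.set0U.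
rewrite (cardsD1 e) eS ltnS => Sk SE.
have eE := fintype.subsetP SE _ eS.
have DE : (S :\ e)%SET \subset E := fintype.subset_trans (finset.subD1set _ _) SE.
pose f' G := ((S :\ e)%SET \subset G)%:R * f G.
rewrite (@eq_Ex _ (fun G => (e \in G)%:R * f' G)); last first.
  by move=> G _; rewrite /f' mulrA -natrM mulnb -finset.sub1set -finset.subUset finset.setD1K.
rewrite Ex_contains1 // exprS -mulrA; congr (_ * _).
rewrite (@eq_Ex _ (fun G => ((S :\ e)%SET \subset G)%:R * f (e |: G)%SET)); last first.
  move=> G _; rewrite /f'; congr (_ * _); congr (nat_of_bool _)%:R.
  apply/fintype.subsetP/fintype.subsetP => H x xS; have := H x xS; rewrite !inE.
    by move: xS; rewrite !inE => /andP[/negbTE->].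
  by move=> ->; rewrite orbT.
rewrite IHk //; congr (_ * _); apply: eq_Ex => G _.
by rewrite finset.setUA finset.setD1K.
Qed.

Lemma Ex_mem e : e \in E -> Ex (fun G => (e \in G)%:R) = p.
Proof.
move=> eE; rewrite (@eq_Ex _ (fun G => (e \in G)%:R * 1)) => [|G _]; last by rewrite mulr1.
by rewrite Ex_contains1 // Ex_cst mulr1.
Qed.

Lemma Ex_mem2 e e' : e \in E -> e' \in E -> e != e' ->
  Ex (fun G => (e \in G)%:R * (e' \in G)%:R) = p ^+ 2.
Proof.
move=> eE e'E ee'; rewrite Ex_contains1 // expr2 -[in X in _ = _ * X](Ex_mem e'E).
by congr (_ * _); apply: eq_Ex => G _; rewrite !inE eq_sym (negbTE ee').
Qed.

(** The weights sum to one, so the maximum of [f] is at least its mean. *)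
Lemma Ex_attained f : exists2 G : {set T}, G \subset E & Ex f <= f G.
Proof.
case: (@Order.TotalTheory.arg_maxP _ _ _ E (fun G : {set T} => G \subset E) f (fintype.subxx E)) => G GE fG.
by exists G; rewrite // -[leRHS]Ex_cst; apply: le_Ex.
Qed.

(** * Avoiding every set of a family *)

Section Janson.
Variables (I : eqType) (S : I -> {set T}).
Hypothesis SE : forall i, S i \subset E.

Definition avoids (l : seq I) G : bool := all (fun i => ~~ (S i \subset G)) l.

Definition overlap i j : bool := S i :&: S j != finset.set0.

(** Janson's conditioning step: avoiding the sets of [l] disjoint from [S i] is independent of [G]
    containing [S i], and the overlapping sets are handled by a union bound. *)
Lemma avoids_step i l :
  Ex (fun G => (avoids (i :: l) G)%:R) <= Ex (fun G => (avoids l G)%:R) *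
    (1 - (p ^+ #|S i| - \sum_(j <- l | overlap i j) p ^+ #|S i :|: S j|)).
Proof.
have p0 : 0 <= p by case/andP: p01.
pose lM := [seq j <- l | ~~ overlap i j].
pose eM := Ex (fun G => (avoids lM G)%:R).
set d := (X in 1 - X).
have e_le : Ex (fun G => (avoids l G)%:R) <= eM.
  apply: le_Ex => G _; rewrite ler_nat /avoids all_filter; case H: all => //.
  by rewrite (sub_all _ H) // => j /= ->; rewrite implybT.
have e_ge0 : 0 <= Ex (fun G => (avoids l G)%:R).
  by apply: sumr_ge0 => G _; rewrite mulr_ge0 ?bern_weight_ge0.
have step : Ex (fun G => (avoids (i :: l) G)%:R) =
    Ex (fun G => (avoids l G)%:R) - Ex (fun G => (S i \subset G)%:R * (avoids l G)%:R).
  rewrite -ExB; apply: eq_Ex => G _; rewrite /avoids /=.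
  by case: (S i \subset G); rewrite ?mul1r ?mul0r ?subr0 ?subrr.
have key : eM * d <= Ex (fun G => (S i \subset G)%:R * (avoids l G)%:R).
  apply: (@le_trans _ _ (Ex (fun G => (S i \subset G)%:R * (avoids lM G)%:R -
     \sum_(j <- l | overlap i j) ((S i :|: S j)%SET \subset G)%:R * (avoids lM G)%:R))).
    rewrite ExB Ex_sum Ex_contains // /d mulrBr [eM * p ^+ _]mulrC [eM * \sum_(_ <- _ | _) _]mulr_sumr.
    apply: lerB.
      (* Independence: adding [S i] to [G] does not affect whether [G] contains a set disjoint from
         [S i]. *)
      rewrite ler_wpM2l ?exprn_ge0 // le_eqVlt; apply/orP; left; apply/eqP.
      apply: eq_Ex => G _; congr (_%:R); rewrite /avoids !all_filter.
      congr nat_of_bool; apply: eq_all => j /=; have [//|/=] := boolP (overlap i j).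
      rewrite negbK finset.setI_eq0 => dij; congr negb.
      apply/fintype.subsetP/fintype.subsetP => H x xj; have := H x xj; rewrite !inE.
        by move=> ->; rewrite orbT.
      by rewrite (disjointFl dij xj).
    (* Harris: enlarging [G] can only destroy the avoidance of [lM], so forcing [S i :|: S j] into
       [G] does not raise its probability. *)
    apply: ler_sum => j _; rewrite Ex_contains ?finset.subUset ?SE // mulrC.
    rewrite ler_wpM2r ?exprn_ge0 //; apply: le_Ex => G _.
    rewrite ler_nat /avoids; case H: all => //.
    rewrite (sub_all _ H) // => k; apply: contra => kG.
    exact: fintype.subset_trans kG (finset.subsetUr _ _).
  apply: le_Ex => G _; rewrite -mulr_suml -mulrBl /avoids all_filter.
  have [aM|aM] := boolP (all _ l); last first.
    by rewrite mulr0 mulr_ge0.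
  rewrite mulr1; have [SG|SG] := boolP (S i \subset G); last first.
    rewrite mul0r sub0r oppr_le0 sumr_ge0 // => j _; exact: ler0n.
  rewrite mul1r; have [al|] := boolP (all _ l).
    by rewrite gerBl sumr_ge0 // => j _; exact: ler0n.
  case/allPn => j jl /negPn jG; rewrite subr_le0.
  have ij : overlap i j by apply: contraLR jG => ij; exact: (implyP (allP aM j jl)).
  rewrite (big_rem j jl) /= ij finset.subUset SG jG lerDl.
  by apply: sumr_ge0 => k _; exact: ler0n.
(* For negative [d] the factor [1 - d] exceeds 1 and the bound is trivial. *)
have [d0|d0] := lerP 0 d; last first.
  rewrite step; apply: (@le_trans _ _ (Ex (fun G => (avoids l G)%:R))).
    rewrite gerBl; apply: sumr_ge0 => G _.
    by rewrite mulr_ge0 ?bern_weight_ge0 // mulr_ge0.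
  by rewrite ler_peMr // lerBrDr gerDl ltW.
rewrite step mulrBr mulr1 lerB // (le_trans _ key) //.
exact: ler_wpM2r.
Qed.

(** Iterates [avoids_step], using [1 - d <= expR (- d)]. *)
Lemma avoids_le_expR l : uniq l ->
  Ex (fun G => (avoids l G)%:R) <= expR (- (\sum_(i <- l) p ^+ #|S i| -
    \sum_(i <- l) \sum_(j <- l | (j != i) && overlap i j) p ^+ #|S i :|: S j|)).
Proof.
have p0 : 0 <= p by case/andP: p01.
elim: l => [_|i l IHl /= /andP[il ul]].
  by rewrite !big_nil subrr oppr0 expR0 -[leRHS](Ex_cst 1).
apply: (le_trans (avoids_step i l)).
set d := (X in 1 - X).
apply: (@le_trans _ _ (expR (- (\sum_(i <- l) p ^+ #|S i| -
    \sum_(i <- l) \sum_(j <- l | (j != i) && overlap i j) p ^+ #|S i :|: S j|)) * expR (- d))).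
  apply: ler_pM => //; last 2 first.
  - exact: IHl.
  - exact: expR_ge1Dx.
  - by apply: sumr_ge0 => G _; rewrite mulr_ge0 ?bern_weight_ge0.
  - rewrite subr_ge0 lerBlDr (le_trans (y := 1)) //.
      by case/andP: p01 => _ p1; exact: exprn_ile1.
    by rewrite lerDl sumr_ge0 // => j _; exact: exprn_ge0.
rewrite -expRD ler_expR -opprD lerN2 [in leLHS]big_cons [X in _ - X <= _]big_cons.
rewrite [X in _ - (X + _) <= _]big_cons eqxx /=.
have -> : \sum_(j <- l | (j != i) && overlap i j) p ^+ #|S i :|: S j| = 
   \sum_(j <- l | overlap i j) p ^+ #|S i :|: S j|.
  rewrite big_seq_cond [RHS]big_seq_cond; apply: eq_bigl => j.
  have [jl|//] := boolP (j \in l); congr andb.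
  by case: eqVneq jl il => //= -> ->.
(* The statement counts each overlapping pair in both orders, the induction only once; the pairs
   [(a, i)] are slack. *)
have : \sum_(a <- l) \sum_(j <- l | (j != a) && overlap a j) p ^+ #|S a :|: S j| <=
   \sum_(a <- l) \sum_(j <- i :: l | (j != a) && overlap a j) p ^+ #|S a :|: S j|.
  apply: ler_sum => a _; rewrite big_cons; case: ifP => // _.
  by rewrite lerDr exprn_ge0.
rewrite /d; lra.
Qed.

End Janson.
End Bernoulli.

(* The bound [avoids_le_expR] on all of [F] is useless when the pairs dominate;
   keeping each index with probability [q] weighs the pairs by [q ^+ 2] against
   [q], and some subfamily does as well as the average one. *)
Lemma janson (R : realType) (T : finType) (E : {set T}) (p q : R) (I : finType)
    (S : I -> {set T}) (F : {set I}) :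
  0 <= p <= 1 -> 0 <= q <= 1 -> (forall i, S i \subset E) ->
  Ex E p (fun G => (avoids S (enum F) G)%:R) <= expR (- (
    q * \sum_(i in F) p ^+ #|S i| -
    q ^+ 2 * \sum_(i in F) \sum_(j in F | (j != i) && overlap S i j) p ^+ #|S i :|: S j|)).
Proof.
move=> p01 q01 SE.
pose a i := p ^+ #|S i|.
pose b i j := p ^+ #|S i :|: S j|.
pose c i j := (j != i) && overlap S i j.
(* For [H] inside [F], [g H] is the negated exponent that [avoids_le_expR] gives for [H]; its mean
   under [Ex F q] is the one in the statement. *)
pose g (H : {set I}) := \sum_(i in F) (i \in H)%:R * a i -
  \sum_(i in F) \sum_(j in F | c i j) (i \in H)%:R * (j \in H)%:R * b i j.
have [H HF] := Ex_attained F q01 g.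
have -> : Ex F q g = q * \sum_(i in F) a i - q ^+ 2 * \sum_(i in F) \sum_(j in F | c i j) b i j.
  rewrite ExB !Ex_sum !mulr_sumr; congr (_ - _).
    apply: eq_bigr => i iF; rewrite (@eq_Ex _ _ _ _ _ (fun G => a i * (i \in G)%:R)).
      by rewrite ExZ Ex_mem // mulrC.
    by move=> G _; rewrite mulrC.
  apply: eq_bigr => i iF; rewrite Ex_sum mulr_sumr; apply: eq_bigr => j /andP[jF /andP[ij _]].
  rewrite (@eq_Ex _ _ _ _ _ (fun G => b i j * ((i \in G)%:R * (j \in G)%:R))).
    by rewrite ExZ Ex_mem2 // 1?eq_sym // mulrC.
  by move=> G _; rewrite mulrC.
move=> gH; apply: (@le_trans _ _ (Ex E p (fun G => (avoids S (enum H) G)%:R))).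
  apply: le_Ex => // G _; rewrite ler_nat; case avF: (avoids S (enum F) G) => //.
  rewrite (_ : avoids S (enum H) G) //; apply/allP => i; rewrite mem_enum => iH.
  by apply: (allP avF); rewrite mem_enum (fintype.subsetP HF).
apply: (le_trans (avoids_le_expR p01 SE (enum_uniq _))).
rewrite ler_expR lerN2 (le_trans gH) // /g le_eqVlt; apply/orP; left; apply/eqP.
have FH i : (i \in F) && (i \in H) = (i \in H).
  by case: (boolP (i \in H)) => [/(fintype.subsetP HF)->|_]; rewrite ?andbF.
congr (_ - _); rewrite big_enum /=.
  rewrite (eq_bigr (fun i => if i \in H then a i else 0)) => [|i _].
    by rewrite -big_mkcondr; apply: eq_bigl => i; rewrite FH.
  by rewrite mulr_natl mulrb.
transitivity (\sum_(i in F) if i \in H then \sum_(j in H | c i j) b i j else 0).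
  apply: eq_bigr => i _; case: ifP => _; last by rewrite big1 // => j _; rewrite !mul0r.
  rewrite (eq_bigr (fun j => if j \in H then b i j else 0)) => [|j _].
    rewrite -big_mkcondr; apply: eq_bigl => j.
    by rewrite -andbA [c i j && _]andbC andbA FH.
  by rewrite mul1r mulr_natl mulrb.
rewrite -big_mkcondr; apply: eq_big => [i|i iF]; first exact: FH.
by rewrite big_enum_cond.
Qed.

(** * Cliques in random graphs *)

(** Each factor [m - k], [k < s], of the falling factorial is at least half of [m]. *)
Lemma exp_le_bin m s : (2 * s <= m)%N -> (m ^ s <= 2 ^ s * s`! * 'C(m, s))%N.
Proof.
move=> sm; rewrite -mulnA [(s`! * _)%N]mulnC bin_ffact.
suff: forall k, (k <= s)%N -> (m ^ k <= 2 ^ k * m ^_ k)%N by apply.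
elim=> // k IHk ks; rewrite ffactnSr !expnS.
have mk : (m <= 2 * (m - k))%N.
  by rewrite mulnBr mul2n -addnn -addnBA ?leq_addr // (leq_trans _ sm) // leq_mul2l /= ltnW.
by apply: leq_trans (leq_mul mk (IHk (ltnW ks))) _; rewrite mulnACA [((m - k) * _)%N]mulnC.
Qed.

Section Cliques.
Variables (R : realType) (n : nat).
Implicit Types (A B J M : {set 'I_n}) (G : {set {set 'I_n}}).

Definition edges_in A : {set {set 'I_n}} := [set e : {set 'I_n} | e \subset A & #|e| == 2%N]%SET.

Lemma card_edges_in A : #|edges_in A| = 'C(#|A|, 2).
Proof. exact: cards_draws. Qed.

Lemma edges_in_pairs A : edges_in A \subset pairs n.
Proof. by apply/fintype.subsetP => e; rewrite !inE => /andP[]. Qed.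

Lemma edges_inI A B : edges_in A :&: edges_in B = edges_in (A :&: B).
Proof.
apply/setP => e; rewrite !inE finset.subsetI.
by case: (#|e| == 2%N); rewrite ?andbF ?andbT.
Qed.

Lemma clique_edges_in G A : edges_in A \subset G -> is_clique G A.
Proof.
move=> /fintype.subsetP AG; apply/cliqueP => x y xA yA xy; apply: AG.
rewrite inE cards2 xy eqxx andbT; apply/fintype.subsetP => z.
by rewrite !inE => /orP[] /eqP ->.
Qed.

Definition draws M s : {set {set 'I_n}} := [set A : {set 'I_n} | A \subset M & #|A| == s]%SET.

(** Removing [J] is injective on the sets containing [J] and leaves subsets of [M] of size
    [s - #|J|]. *)
Lemma card_draws_above M J s : (#|[set A in draws M s | J \subset A]%SET| <= #|M| ^ (s - #|J|))%N.
Proof.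
set X := [set _ in _ | _]%SET.
have inj : {in X &, injective (fun A => A :\: J)%SET}.
  move=> A B; rewrite !inE => /andP[_ JA] /andP[_ JB] eAB.
  by rewrite -(finset.setID A J) -(finset.setID B J) eAB (finset.setIidPr JA) (finset.setIidPr JB).
rewrite -(card_in_imset inj); apply: leq_trans (bin_le_exp _ _).
rewrite -cards_draws; apply/subset_leq_card/fintype.subsetP => _ /imsetP[A + ->].
rewrite !inE => /andP[/andP[AM /eqP <-] JA].
rewrite (fintype.subset_trans (finset.subsetDl _ _) AM) /=.
by rewrite cardsD (finset.setIidPr JA).
Qed.

(** Sort the sets [B] by a common part [J] with [A], of size [j >= 2]: at most [#|M| ^ (s - j)] of
    them contain [J], and the bound on [lam] supplies the missing [#|M| ^ j] and [p ^ 'C(j, 2)].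
    There are at most [2 ^ s] choices of [J]. *)
Lemma clique_pairs_sum (p lam : R) M s A :
  0 <= p -> 0 <= lam -> A \in draws M s ->
  (forall j, (2 <= j <= s)%N -> lam <= #|M|%:R ^+ j * p ^+ 'C(j, 2)) ->
  lam * (\sum_(B in draws M s | (B != A) && overlap edges_in A B)
           p ^+ #|edges_in A :|: edges_in B|) <=
  2 ^+ s * (#|M|%:R ^+ s * p ^+ ('C(s, 2) + 'C(s, 2))).
Proof.
move=> p0 lam0 AD hlam; move: (AD); rewrite inE => /andP[AM /eqP cA].
set m := #|M|.
pose w J := p ^+ ('C(s, 2) + 'C(s, 2) - 'C(#|J|, 2)).
apply: (@le_trans _ _ (lam * \sum_(J in powerset A | (2 <= #|J|)%N) \sum_(B in draws M s | J \subset B) w J)).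
  rewrite ler_wpM2l // (exchange_big_dep (mem (draws M s))) /=; last by move=> ? ? _ /andP[].
  rewrite big_mkcondr; apply: ler_sum => B BD; case: ifP => [/andP[BA mAB]|_]; last first.
    by apply: sumr_ge0 => J _; exact: exprn_ge0.
  (* The term [J = A :&: B] alone already gives the required power of [p]. *)
  rewrite (bigD1 (A :&: B)%SET) /=; last first.
    rewrite powersetE finset.subsetIl BD finset.subsetIr !andbT /=.
    case/set0Pn: mAB => e; rewrite edges_inI inE => /andP[eAB /eqP e2].
    by rewrite -e2 subset_leq_card.
  move: BD; rewrite inE => /andP[_ /eqP cB].
  rewrite cardsU edges_inI !card_edges_in cA cB lerDl.
  by apply: sumr_ge0 => J _; exact: exprn_ge0.
rewrite mulr_sumr; apply: (@le_trans _ _ (\sum_(J in powerset A | (2 <= #|J|)%N)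
    m%:R ^+ s * p ^+ ('C(s, 2) + 'C(s, 2)))).
  apply: ler_sum => J /andP[]; rewrite powersetE => JA J2.
  have Js : (#|J| <= s)%N by rewrite -cA subset_leq_card.
  rewrite sumr_const.
  have -> : #|[pred B in draws M s | J \subset B]| = #|[set B in draws M s | J \subset B]%SET|.
    by rewrite cardsE.
  rewrite -[w J *+ _]mulr_natr mulrA.
  apply: (@le_trans _ _ (m%:R ^+ #|J| * p ^+ 'C(#|J|, 2) * w J * m%:R ^+ (s - #|J|))).
    apply: ler_pM => //; first by rewrite mulr_ge0 ?exprn_ge0.
      by rewrite ler_wpM2r ?exprn_ge0 // hlam // J2.
    by rewrite -natrX ler_nat card_draws_above.
  have Ck : ('C(#|J|, 2) <= 'C(s, 2) + 'C(s, 2))%N.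
    by rewrite (leq_trans (leq_bin2l 2 Js)) ?leq_addr.
  have -> : p ^+ ('C(s, 2) + 'C(s, 2)) = p ^+ 'C(#|J|, 2) * w J by rewrite -exprD subnKC.
  have -> : m%:R ^+ s = m%:R ^+ #|J| * m%:R ^+ (s - #|J|) :> R by rewrite -exprD subnKC.
  by rewrite le_eqVlt; apply/orP; left; apply/eqP; ring.
rewrite big_mkcondr; apply: (@le_trans _ _ (\sum_(J in powerset A) m%:R ^+ s * p ^+ ('C(s, 2) + 'C(s, 2)))).
  by apply: ler_sum => J _; case: ifP => // _; rewrite mulr_ge0 ?exprn_ge0.
by rewrite sumr_const card_powerset cA -[leLHS]mulr_natl natrX.
Qed.

Lemma no_clique_prob (p lam : R) M s :
  0 < p <= 1 -> 0 < lam -> (1 < s)%N -> (2 * s <= #|M|)%N ->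
  (forall j, (2 <= j <= s)%N -> lam <= #|M|%:R ^+ j * p ^+ 'C(j, 2)) ->
  Ex (pairs n) p (fun G => (avoids edges_in (enum (draws M s)) G)%:R) <=
  expR (- (lam / (4 * (4 ^+ s * (s`!)%:R)))).
Proof.
move=> /andP[p0 p1] lam0 s1 sM hlam.
have sum1 : \sum_(A in draws M s) p ^+ #|edges_in A| = #|draws M s|%:R * p ^+ 'C(s, 2).
  rewrite (eq_bigr (fun=> p ^+ 'C(s, 2))) ?sumr_const ?mulr_natl // => A.
  by rewrite inE card_edges_in => /andP[_ /eqP ->].
set mu := #|draws M s|%:R * p ^+ 'C(s, 2) in sum1.
set D := \sum_(A in draws M s) \sum_(B in draws M s | (B != A) && overlap edges_in A B)
           p ^+ #|edges_in A :|: edges_in B|.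
(* One factor [2 ^+ s] counts the sets [J] of [clique_pairs_sum]; the rest, [2 ^+ s * s!], comes
   from [exp_le_bin]. *)
set c : R := 4 ^+ s * (s`!)%:R.
have c0 : 0 < c by rewrite mulr_gt0 ?exprn_gt0 ?ltr0n ?fact_gt0.
have f0 : 0 < (s`!)%:R :> R by rewrite ltr0n fact_gt0.
have mF : #|M|%:R ^+ s <= 2 ^+ s * (s`!)%:R * #|draws M s|%:R :> R.
  by rewrite cards_draws -!natrX -!natrM ler_nat exp_le_bin.
have lamD : lam * D <= c * mu ^+ 2.
  rewrite mulr_sumr.
  apply: (@le_trans _ _ (\sum_(A in draws M s) 2 ^+ s * (#|M|%:R ^+ s * p ^+ ('C(s, 2) + 'C(s, 2))))).
    by apply: ler_sum => A AD; apply: clique_pairs_sum => //; exact: ltW.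
  rewrite sumr_const -[leLHS]mulr_natl.
  apply: (@le_trans _ _ (#|draws M s|%:R *
      (2 ^+ s * (2 ^+ s * (s`!)%:R * #|draws M s|%:R * p ^+ ('C(s, 2) + 'C(s, 2)))))).
    do 2 (rewrite ler_wpM2l ?exprn_ge0 //).
    by rewrite ler_wpM2r ?exprn_ge0 // ltW.
  rewrite le_eqVlt; apply/orP; left; apply/eqP.
  have -> : c = 2 ^+ s * 2 ^+ s * (s`!)%:R by rewrite /c -exprMn -natrM.
  by rewrite /mu exprD; ring.
have lammu : lam <= c * mu.
  apply: (le_trans (hlam s _)); first by rewrite s1 leqnn.
  apply: (@le_trans _ _ (2 ^+ s * (s`!)%:R * #|draws M s|%:R * p ^+ 'C(s, 2))).
    by rewrite ler_wpM2r ?exprn_ge0 // ltW.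
  rewrite /mu mulrA ler_wpM2r ?exprn_ge0 ?(ltW p0) // ler_wpM2r //.
  by rewrite /c ler_wpM2r // ?(ltW f0) // lerXn2r ?nnegrE // ler_nat.
have mu0 : 0 < mu by rewrite -(pmulr_rgt0 _ c0); exact: lt_le_trans lam0 lammu.
(* This [q] maximises [q * mu - q ^+ 2 * (c * mu ^+ 2 / lam)], with value [lam / (4 * c)]; it is at
   most 1 by [lammu], the case [j = s] of [hlam]. *)
pose q := lam / (2 * c * mu).
have c2mu : 0 < 2 * c * mu by apply: mulr_gt0 => //; exact: mulr_gt0.
have q0 : 0 <= q by rewrite /q divr_ge0 ?(ltW c2mu) ?(ltW lam0).
have q1 : q <= 1.
  rewrite /q ler_pdivrMr // mul1r (le_trans lammu) //.
  by rewrite ler_wpM2r ?(ltW mu0) // ler_peMl ?(ltW c0) // ler1n.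
have p01 : 0 <= p <= 1 by rewrite ltW.
apply: (le_trans (@janson _ _ _ _ q _ edges_in (draws M s) p01 _ edges_in_pairs)).
  by rewrite q0.
rewrite ler_expR lerN2 sum1 -/D.
have cn0 : c != 0 by rewrite gt_eqF.
have mun0 : mu != 0 by rewrite gt_eqF.
clearbody mu c D.
have qmu : q * mu = 2 * (lam / (4 * c)) by rewrite /q; field; rewrite ?cn0 ?mun0.
have q2D : q ^+ 2 * D <= lam / (4 * c).
  have -> : q ^+ 2 * D = lam * D * (lam / (4 * c ^+ 2 * mu ^+ 2)) by rewrite /q; field; rewrite ?cn0 ?mun0.
  apply: (@le_trans _ _ (c * mu ^+ 2 * (lam / (4 * c ^+ 2 * mu ^+ 2)))).
    by rewrite ler_wpM2r // divr_ge0 ?mulr_ge0 ?exprn_ge0 // ltW.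
  by rewrite le_eqVlt; apply/orP; left; apply/eqP; field; rewrite ?cn0 ?mun0.
lra.
Qed.

End Cliques.

(* The right-hand side is at least [K * t ^+ ((j - 1) * (s - j + 1)) * m], whose
   exponent is smallest at the endpoints [j = 2] and [j = s]. *)
Lemma clique_density (R : realFieldType) (K u t m : R) (s j : nat) :
  1 <= K -> 0 < u -> 1 <= t -> u * t <= 1 -> 0 <= m -> K * t <= m * u ^+ s ->
  (2 <= j <= s)%N ->
  K * t ^+ s.-1 * m <= m ^+ j * (u ^+ 2) ^+ 'C(j, 2).
Proof.
move=> K1 u0 t1 ut1 m0 Km; case: j => [//|[//|i]] /andP[_ js].
have -> : (u ^+ 2) ^+ 'C(i.+2, 2) = (u ^+ i.+2) ^+ i.+1.
  by rewrite -!exprM; congr (_ ^+ _); rewrite -(mul_bin_diag i.+2 1) bin1.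
rewrite exprS [_ * m]mulrC -mulrA -exprMn ler_wpM2l //.
have [t0 K0] : 0 <= t /\ 0 <= K by split; exact: le_trans ler01 _.
set d := (s - i.+2)%N.
have sE : s = (i.+2 + d)%N by rewrite subnKC.
(* Multiplying the hypothesis on [m * u ^+ s] by [t ^+ d] trades [d] factors [u] for [u * t <= 1];
   the result is then raised to the power [j - 1]. *)
have B : K * t ^+ d.+1 <= m * u ^+ i.+2.
  rewrite exprS mulrA; apply: (@le_trans _ _ (m * u ^+ s * t ^+ d)).
    by rewrite ler_wpM2r ?exprn_ge0.
  have us : u ^+ s = u ^+ i.+2 * u ^+ d by rewrite -exprD -sE.
  rewrite us; set a := u ^+ i.+2; have a0 : 0 <= a by exact/exprn_ge0/ltW.
  have -> : m * (a * u ^+ d) * t ^+ d = m * a * (u * t) ^+ d by rewrite exprMn; ring.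
  apply: ler_piMr; first exact: mulr_ge0.
  by apply: exprn_ile1; rewrite // mulr_ge0 // ltW.
apply: (@le_trans _ _ ((K * t ^+ d.+1) ^+ i.+1)); last first.
  by apply: lerXn2r => //; rewrite nnegrE mulr_ge0 // exprn_ge0 // ltW.
rewrite exprMn ler_pM ?exprn_ge0 //.
  by rewrite exprS ler_peMr // exprn_ege1.
rewrite -exprM ler_weXn2l // sE /= mulSn mulnS.
by rewrite leq_add2l leq_addr.
Qed.

(** * Union bound over the sets of [m] vertices *)

Section Union.
Variables (R : realType) (r n : nat) (p : R).
Hypothesis p01 : 0 <= p <= 1.

Lemma Gnp_probE (P : pred {set {set 'I_n}}) :
  Gnp_prob p P = Ex (pairs n) p (fun G => (P G)%:R).
Proof.
rewrite /Gnp_prob big_mkcondr; apply: eq_bigr => G _.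
by rewrite mulr_natr mulrb.
Qed.

Lemma Gnp_prob_le1 (P : pred {set {set 'I_n}}) : Gnp_prob p P <= 1.
Proof.
rewrite Gnp_probE -[leRHS](Ex_cst (pairs n) p); apply: le_Ex => // G _.
by case: (P G).
Qed.

Lemma S_count_prob m (B eps : R) : (2 < r)%N -> (0 < n)%N ->
  ((n.+1 ^ m) ^ n)%:R <= B ->
  (forall M : {set 'I_n}, #|M| = m ->
     Ex (pairs n) p (fun G => (avoids (@edges_in n) (enum (draws M r.-1)) G)%:R) <= eps) ->
  1 - 'C(n, m)%:R * eps <= Gnp_prob p (fun G : {set {set 'I_n}} => (S_count r G)%:R <= B).
Proof.
move=> r3 n0 hB heps; rewrite Gnp_probE.
(* [bad G] counts the [m]-sets without a [K_(r-1)]. If there is one, [1 - bad G] is nonpositive;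
   otherwise [S_count_le] applies. So [1 - bad G] is at most the indicator of the event. *)
pose bad G := \sum_(M in draws [set: 'I_n] m) (avoids (@edges_in n) (enum (draws M r.-1)) G)%:R : R.
apply: (@le_trans _ _ (Ex (pairs n) p (fun G => 1 - bad G))).
  rewrite ExB Ex_cst Ex_sum lerB //.
  apply: (@le_trans _ _ (\sum_(M in draws [set: 'I_n] m) eps)).
    by apply: ler_sum => M; rewrite inE => /andP[_ /eqP]; exact: heps.
  by rewrite sumr_const cards_draws cardsT card_ord mulr_natl.
apply: le_Ex => // G _.
have [/existsP[M /andP[MD aM]]|/existsPn good] := boolP [exists M : {set 'I_n},
    (M \in draws [set: 'I_n] m) && avoids (@edges_in n) (enum (draws M r.-1)) G].
  apply: (@le_trans _ _ 0); last exact: ler0n.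
  rewrite subr_le0 /bad (bigD1 M) //= aM lerDl.
  by apply: sumr_ge0 => ? _; exact: ler0n.
apply: (@le_trans _ _ 1); first by rewrite gerBl; apply: sumr_ge0 => ? _; exact: ler0n.
rewrite (_ : (S_count r G)%:R <= B) //; apply: le_trans hB; rewrite ler_nat.
apply: S_count_le => // M cM.
have := good M; rewrite inE finset.subsetT cM eqxx /= => /allPn[A].
rewrite mem_enum inE negbK => /andP[AM /eqP cA] AG.
by exists A; split=> //; exact: clique_edges_in.
Qed.

End Union.

(** The 12 in [K] makes each [m]-set fail with probability at most [expR (- 3 L m)], which beats the
    at most [n ^ m = expR (L m)] sets. The 4 comes from [n + 1 <= n ^ 2] and [m <= 2 y]. *)
Lemma S_count_bound_prob (R : realType) (r n : nat) (p : R) : (4 <= r)%N ->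
  let K : R := 12 * (4 ^+ r.-1 * (r.-1)`!%:R) in
  0 < p <= 1 -> expR 1 <= n%:R :> R ->
  p <= ln (n%:R : R) `^ (- (2 / (r%:R - 2))) ->
  1 - n.+1%:R^-1 <= Gnp_prob p (fun G : {set {set 'I_n}} => (S_count r G)%:R <=
          expR (4 * K * (n%:R * ln (n%:R : R) `^ (1 + 1 / (r%:R - 2)))
                / p `^ ((r%:R - 1) / 2))).
Proof.
case: r => // s s3 K /andP[p0 p1] ne pL; rewrite ltnS in s3.
pose c : R := 4 ^+ s * (s`!)%:R.
set L := ln (n%:R : R) in pL *.
have nR0 : 0 < n%:R :> R by exact: lt_le_trans (expR_gt0 _) ne.
have n0 : (0 < n)%N by rewrite -(ltr0n R).
have nL : n%:R = expR L :> R by rewrite lnK.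
have L1 : 1 <= L by rewrite -ler_expR -nL.
have L0 : 0 <= L := le_trans ler01 L1.
have L0' : 0 < L := lt_le_trans ltr01 L1.
have c1 : 1 <= c.
  by rewrite /c -natrX -natrM ler1n muln_gt0 expn_gt0 fact_gt0.
pose e : R := 1 / (s.+1%:R - 2).
have sE : s.+1%:R - 2 = (s.-1)%:R :> R.
  by rewrite -(ltn_predK s3) /= -addn2 natrD addrK.
have s1n0 : (s.-1)%:R != 0 :> R.
  by rewrite pnatr_eq0 -lt0n; case: (s) s3 => // -[].
pose t := L `^ e.
have tX : t ^+ s.-1 = L.
  by rewrite /t -powR_mulrn ?powR_ge0 // -powRrM /e sE mul1r mulVf // powRr1.
have e0 : 0 <= e by rewrite /e sE divr_ge0.
have t1 : 1 <= t by rewrite -(powRr0 L); apply: ler_powR.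
have t0 : 0 < t := lt_le_trans ltr01 t1.
pose u := Num.sqrt p.
have u0 : 0 < u by rewrite sqrtr_gt0.
have u2 : u ^+ 2 = p by rewrite sqr_sqrtr // ltW.
(* This is the upper bound on [p], since [t ^+ 2] is [L] to the power [2 / (r - 2)]. *)
have ut1 : u * t <= 1.
  rewrite -(@ler_pXn2r _ 2) // ?nnegrE ?mulr_ge0 ?(ltW u0) ?(ltW t0) //.
  rewrite expr1n exprMn u2 -ler_pdivlMr ?exprn_gt0 // mul1r.
  apply: (le_trans pL); rewrite powRN lef_pV2 ?posrE ?exprn_gt0 ?powR_gt0 //.
  by rewrite /t -powR_mulrn ?powR_ge0 // -powRrM /e mul1r mulrC.
have u1 : u <= 1.
  by apply: le_trans ut1; rewrite ler_peMr // ltW.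
have pu : p `^ ((s.+1%:R - 1) / 2) = u ^+ s.
  by rewrite -natr1 addrK mulrC powRrM powR12_sqrt ?(ltW p0) // powR_mulrn ?sqrtr_ge0.
have LE : L `^ (1 + 1 / (s.+1%:R - 2)) = L * t.
  by rewrite powRD ?powRr1 // (gt_eqF L0') implybT.
rewrite pu LE.
pose y := K * t / u ^+ s.
have K12 : K = 12 * c by [].
have tu1 : 1 <= t / u ^+ s.
  by rewrite ler_pdivlMr ?exprn_gt0 // mul1r (le_trans _ t1) // exprn_ile1 // ltW.
have yK : K <= y by rewrite /y -mulrA ler_peMr // K12; lra.
have y1 : 1 <= y by apply: le_trans yK; rewrite K12; lra.
(* The successor gives [y < m], that is [K * t < m * u ^+ s]; as [1 <= y], it costs at most a factor
   2. *)
pose m := (Num.trunc y).+1.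
have ym : y < m%:R by exact: truncnS_gt.
have my : m%:R <= 2 * y.
  have : (Num.trunc y)%:R <= y by rewrite truncn_le (le_trans ler01).
  by rewrite /m -natr1; lra.
have sm : (2 * s <= m)%N.
  rewrite -(ler_nat R) (le_trans _ (ltW ym)) // (le_trans _ yK) // K12 natrM.
  have sc : s%:R <= c.
    rewrite /c -natrX -natrM ler_nat; apply: leq_trans (leq_pmulr _ (fact_gt0 s)).
    exact/ltnW/ltn_expl.
  by lra.
(* Equal to [K * t ^+ s.-1 * m], the bound of [clique_density]. *)
pose lam := 12 * c * (L * m%:R).
have hlam j : (2 <= j <= s)%N -> lam <= m%:R ^+ j * p ^+ 'C(j, 2).
  move=> js; rewrite /lam mulrA -K12 -{1}tX -u2; apply: clique_density => //.
    by rewrite K12; lra.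
  by rewrite -ler_pdivrMr ?exprn_gt0 // ltW.
have m0 : 0 < m%:R :> R by rewrite ltr0n.
have c0 : 0 < c := lt_le_trans ltr01 c1.
have n1n2 : n.+1%:R <= n%:R ^+ 2 :> R.
  have n2 : (2 <= n)%N.
    rewrite -(ler_nat R) (le_trans _ ne) // (le_trans _ (expR_ge1Dx _)) //.
  by rewrite -natrX ler_nat -addn1 -mulnn (leq_trans _ (leq_mul n2 (leqnn n))) // mul2n -addnn leq_add2l.
have L2 : expR (2 * L) = n%:R ^+ 2 by rewrite nL -expRM_natl.
apply: (@le_trans _ _ (1 - 'C(n, m)%:R * expR (- (3 * (L * m%:R))))).
  (* The total failure probability is at most [expR (- 2 L m)], hence at most [n ^ (- 2)]. *)
  rewrite lerB //; apply: (@le_trans _ _ (n%:R ^+ m * expR (- (3 * (L * m%:R))))).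
    by rewrite ler_wpM2r ?expR_ge0 // -natrX ler_nat bin_le_exp.
  rewrite nL -expRM_natr -expRD (_ : L * m%:R + _ = - (2 * L * m%:R)); last by ring.
  rewrite expRN lef_pV2 ?posrE ?expR_gt0 ?ltr0n // (le_trans n1n2) // -L2 ler_expR.
  by rewrite ler_peMr ?ler1n // mulr_ge0.
apply: S_count_prob => //.
- by rewrite ltW.
- by rewrite ltnS ltnW.
- rewrite natrX natrX; apply: (@le_trans _ _ ((expR (2 * L) ^+ m) ^+ n)).
    by rewrite !lerXn2r ?nnegrE ?exprn_ge0 ?expR_ge0 ?ler0n // L2.
  rewrite -!expRM_natr ler_expR (_ : 4 * K * _ / _ = 2 * L * (2 * y) * n%:R); last first.
    by rewrite /y; field; rewrite expf_neq0 // gt_eqF.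
  by rewrite ler_wpM2r // ler_wpM2l // mulr_ge0.
move=> M cM; apply: (le_trans (@no_clique_prob _ _ _ lam _ _ _ _ _ _ _)).
- by rewrite p0.
- by rewrite /lam !mulr_gt0.
- exact: ltnW.
- by rewrite cM.
- by rewrite cM.
rewrite ler_expR lerN2 -/c le_eqVlt; apply/orP; left; apply/eqP.
by rewrite /lam; field; rewrite gt_eqF.
Qed.

(** * Passage to the limit *)

Local Open Scope classical_set_scope.

Theorem theorem5p1 (R : realType) (r : nat) (hr : (4 <= r)%N) :
  exists C : R, 0 < C /\
    forall p : nat -> R,
      (forall n, 0 <= p n <= 1) ->
      much_less (fun n => n%:R `^ (- (2 / (r%:R + 1)))) p ->
      (\forall n \near \oo, p n <= ln (n%:R : R) `^ (- (2 / (r%:R - 2)))) ->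
      whp p (fun n G =>
        (S_count r G)%:R <=
          expR (C * (n%:R * ln (n%:R : R) `^ (1 + 1 / (r%:R - 2)))
                / p n `^ ((r%:R - 1) / 2))).
Proof.
exists (4 * (12 * (4 ^+ r.-1 * (r.-1)`!%:R))); split.
  by rewrite !mulr_gt0 ?exprn_gt0 ?ltr0n ?fact_gt0.
move=> p p01 [p_neq0 _] pL.
(* [harmonic n] is [n.+1%:R^-1], the failure probability allowed by [S_count_bound_prob]. *)
apply: (@squeeze_cvgr _ _ _ _ (fun n => 1 - harmonic n) (fun=> 1)).
- near=> n; rewrite Gnp_prob_le1 // andbT.
  apply: S_count_bound_prob => //.
  + have /andP[pn0 ->] := p01 n; rewrite andbT lt_neqAle pn0 andbT eq_sym.
    by near: n.
  + by near: n; exact: nbhs_infty_ger.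
  + by near: n.
- rewrite -[X in _ --> X]subr0; apply: cvgB; first exact: cvg_cst.
  exact: cvg_harmonic.
- exact: cvg_cst.
Unshelve. all: by end_near.
Qed.
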